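(* Let $D_3,D_4,D_5$ be the edge-ordered graphs on the four vertices $a,b,v,w$ with exactly the five edges $ab,av,aw,bv,bw$, with edge orders \[D_3:\ l(ab)<l(av)<l(aw)<l(bv)<l(bw),\] \[D_4:\ l(ab)<l(av)<l(bv)<l(aw)<l(bw),\] \[D_5:\ l(ab)<l(av)<l(bv)<l(bw)<l(aw).\] Then $sat_m(n,D_i)=\Theta(n)$ for each $i\in\{3,4,5\}$.
   Context: An edge-ordered graph is a finite simple graph together with a linear order on its edge set given by an injective labeling $l$ to $\mathbb{N}$ or $\mathbb{R}$. An edge-ordered graph $H$ contains $G$ (has a copy of $G$) if $G$ is isomorphic, by an isomorphism respecting the edge-order, to a subgraph of $H$ with the induced order; otherwise $H$ is $G$-free. $sat_m(n,G)$ is the minimum number of edges in a $G$-free edge-ordered graph $H$ on $n$ vertices such that adding to $H$ any missing edge, inserted at the beginning of the linear order (i.e. with a label smaller than all labels of $H$), creates a copy of $G$. Asymptotic notation is for $n\to\infty$. *)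

(* Defs.v *)
From mathcomp Require Import all_boot.
From mathcomp Require Import boolp.

Set Implicit Arguments.
Unset Strict Implicit.
Unset Printing Implicit Defensive.

(* Edges are 2-element vertex sets; only the values of the labeling on the     *)
(* edges, and only their relative order, are meaningful.                       *)
Record eograph (V : finType) := EOGraph {
  edges : {set {set V}};
  label : {set V} -> nat;
  edges_card2 : {in edges, forall e : {set V}, #|e| = 2};
  label_inj : {in edges &, injective label}
}.

(* f is an order-preserving isomorphism from G onto the subgraph of H with     *)
(* vertex set f @: V and edge set the image of the edges of G, this subgraph   *)
(* being equipped with the order induced by H.                                 *)
Definition is_copy (V W : finType) (G : eograph V) (H : eograph W)
    (f : V -> W) : Prop :=
  [/\ injective f,
      {in edges G, forall e : {set V}, f @: e \in edges H}
    & {in edges G &, forall e1 e2 : {set V},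
        (label H (f @: e1) < label H (f @: e2)) = (label G e1 < label G e2)}].

Definition has_copy (V W : finType) (G : eograph V) (H : eograph W) : Prop :=
  exists f : V -> W, is_copy G H f.

Definition eo_free (V W : finType) (G : eograph V) (H : eograph W) : Prop :=
  ~ has_copy G H.

(* Inserting the edge e at the beginning of the order: labels being natural    *)
(* numbers, the old ones are all raised by one and the label 0 is given to e.  *)
(* Only meant for a missing edge e.                                            *)
Section AddFirst.
Variables (W : finType) (H : eograph W) (e : {set W}).
Hypothesis e_card2 : #|e| = 2.

Let add_label (x : {set W}) : nat := if x == e then 0 else (label H x).+1.

Fact add_first_card2 : {in e |: edges H, forall x : {set W}, #|x| = 2}.
Proof. by move=> x /setU1P[->|/edges_card2]. Qed.

Fact add_first_inj : {in e |: edges H &, injective add_label}.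
Proof.
move=> x y; rewrite !inE /add_label.
case: (eqVneq x e) => [->|_] /=; case: (eqVneq y e) => [->|_] //= xH yH [].
exact: (label_inj xH yH).
Qed.

Definition add_first : eograph W := EOGraph add_first_card2 add_first_inj.
End AddFirst.

Definition saturated_m (V W : finType) (G : eograph V) (H : eograph W) : Prop :=
  eo_free G H /\
  forall (e : {set W}) (e_card2 : #|e| = 2),
    e \notin edges H -> has_copy G (add_first H e_card2).

Definition sat_m_size (n : nat) (V : finType) (G : eograph V) (k : nat) : Prop :=
  exists H : eograph 'I_n, saturated_m G H /\ #|edges H| = k.

(* The default value 0 is used only if no saturated graph exists, which does   *)
(* not happen when G has an edge (lemma sat_mP).                               *)
Definition sat_m (n : nat) (V : finType) (G : eograph V) : nat :=
  match pselect (exists k, `[< sat_m_size n G k >]) with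
  | left exk => ex_minn exk
  | right _ => 0
  end.

Lemma sat_mP (n : nat) (V : finType) (G : eograph V) : edges G != set0 ->
  sat_m_size n G (sat_m n G) /\
  forall k, sat_m_size n G k -> sat_m n G <= k.
Proof.
move=> /set0Pn[g gG]; rewrite /sat_m; case: pselect => [exk|]; last first.
  case.
  suff ext m (H : eograph 'I_n) : #|~: edges H| <= m -> eo_free G H ->
      exists H' : eograph 'I_n, saturated_m G H'.
    have c0 : {in set0, forall e : {set 'I_n}, #|e| = 2}.
      by move=> e; rewrite inE.
    have i0 : {in set0 &, injective (fun _ : {set 'I_n} => 0)}.
      by move=> e; rewrite inE.
    case: (ext _ (EOGraph c0 i0) (leqnn _)).
      by case=> f [_ /(_ _ gG)]; rewrite inE.
    by move=> H satH; exists #|edges H|; apply/asboolP; exists H.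
  elim: m H => [|m IHm] H leHm freeH; have [satH|nsatH] := pselect (saturated_m G H).
  - by exists H.
  - case: nsatH; split=> // e c eNH; move: leHm.
    by rewrite leqn0 cards_eq0 => /eqP/setP/(_ e); rewrite !inE eNH.
  - by exists H.
  - have [e [c [eNH ncp]]] : exists e : {set 'I_n}, exists c : #|e| = 2,
        e \notin edges H /\ ~ has_copy G (add_first H c).
      apply: contrapT => nex; apply: nsatH; split=> // e c eNH.
      by apply: contrapT => ncp; apply: nex; exists e, c.
    apply: (IHm (add_first H c)) => //=; rewrite -ltnS (leq_trans _ leHm) //.
    by rewrite setCU setIC -setDE [X in _ < X](cardsD1 e) inE eNH.
case: ex_minnP => k /asboolP satk mink; split=> // j satj.
by apply: mink; apply/asboolP.
Qed.

Section OfList.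
Variables (V : finType) (s : seq {set V}).
Hypothesis s_card2 : all (fun e : {set V} => #|e| == 2) s.

Fact eograph_of_list_card2 : {in [set e in s], forall e : {set V}, #|e| = 2}.
Proof. by move=> e; rewrite inE => /(allP s_card2)/eqP. Qed.

Fact eograph_of_list_inj : {in [set e in s] &, injective (index^~ s)}.
Proof. by move=> x y; rewrite !inE => xs ys eq_xy; rewrite -(nth_index x xs) eq_xy nth_index. Qed.

(* The graph whose edges, in increasing order, are listed by s.                *)
Definition eograph_of_list : eograph V :=
  EOGraph eograph_of_list_card2 eograph_of_list_inj.
End OfList.

Definition va : 'I_4 := @Ordinal 4 0 isT.
Definition vb : 'I_4 := @Ordinal 4 1 isT.
Definition vv : 'I_4 := @Ordinal 4 2 isT.
Definition vw : 'I_4 := @Ordinal 4 3 isT.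

Definition D3_list : seq {set 'I_4} :=
  [:: [set va; vb]; [set va; vv]; [set va; vw]; [set vb; vv]; [set vb; vw]].
Definition D4_list : seq {set 'I_4} :=
  [:: [set va; vb]; [set va; vv]; [set vb; vv]; [set va; vw]; [set vb; vw]].
Definition D5_list : seq {set 'I_4} :=
  [:: [set va; vb]; [set va; vv]; [set vb; vv]; [set vb; vw]; [set va; vw]].

Fact D3_card2 : all (fun e : {set 'I_4} => #|e| == 2) D3_list.
Proof. by rewrite /= !cards2. Qed.
Fact D4_card2 : all (fun e : {set 'I_4} => #|e| == 2) D4_list.
Proof. by rewrite /= !cards2. Qed.
Fact D5_card2 : all (fun e : {set 'I_4} => #|e| == 2) D5_list.
Proof. by rewrite /= !cards2. Qed.

Definition D3 : eograph 'I_4 := eograph_of_list D3_card2.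
Definition D4 : eograph 'I_4 := eograph_of_list D4_card2.
Definition D5 : eograph 'I_4 := eograph_of_list D5_card2.

(* Main.v *)
(* Lower bound: in a saturated graph every vertex x is covered by an edge.  If
   xy is missing, x is the image of a vertex u of D_i in the copy created by xy,
   and u has a second edge, whose image was already present.  So n <= 2 |E|.
   Upper bound: take the complete split graph K_2 + \overline{K_{n-2}} with the
   edge between the two hubs labeled last.  In a copy of D_i the two triangles
   force ab onto the hub edge, but ab is the first edge of D_i, so the graph is
   D_i-free.  A missing edge xy joins two non-hubs, and together with the hubs it
   forms a diamond whose 4-cycle gets the order of D_i when the edge from hub
   b in {0,1} to i is labeled 2i + b for D_3, bn + i for D_4, and i (b = 0) or
   2n - i (b = 1) for D_5. *)

Require Import Defs.
From mathcomp Require Import all_boot all_order all_algebra zify.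
From mathcomp Require Import all_classical all_reals all_analysis.
Import numFieldNormedType.Exports.

Set Implicit Arguments.
Unset Strict Implicit.
Unset Printing Implicit Defensive.

(** * Copies in edge-ordered graphs and the lower bound *)

Lemma copy_of_list (V W : finType) (s : seq {set V})
    (s_card2 : all (fun e : {set V} => #|e| == 2) s) (H : eograph W)
    (f : V -> W) :
  injective f -> {in s, forall e : {set V}, f @: e \in edges H} ->
  sorted ltn [seq label H (f @: e) | e : {set V} <- s] ->
  is_copy (eograph_of_list s_card2) H f.
Proof.
move=> f_inj fH; rewrite sorted_map => srt; split=> //= [e|e1 e2].
  by rewrite inE => /fH.
rewrite !inE => e1s e2s; have tr : transitive (relpre (fun e : {set V} => label H (f @: e)) ltn).
  by move=> y x z; apply: ltn_trans.
have mono := sorted_ltn_index tr srt.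
case: (ltngtP (index e1 s) (index e2 s)) => [lt12|lt21|eq12].
- exact: mono.
- by apply/negbTE; rewrite -leqNgt ltnW //; apply: mono.
- by rewrite -(nth_index e1 e1s) eq12 nth_index ?ltnn.
Qed.

(** Old labels are all raised by one, so away from [e] the order is that of [H]. *)
Lemma copy_avoiding_new_edge (V W : finType) (G : eograph V) (H : eograph W)
    (e : {set W}) (e_card2 : #|e| = 2) (f : V -> W) :
  is_copy G (add_first H e_card2) f ->
  {in edges G, forall g : {set V}, f @: g != e} -> is_copy G H f.
Proof.
case=> f_inj fH ford fe; split=> // [g gG|g1 g2 g1G g2G].
  by have := fH _ gG; rewrite !inE (negbTE (fe _ gG)).
by rewrite -ford //= (negbTE (fe _ g1G)) (negbTE (fe _ g2G)) ltnS.
Qed.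

Lemma leq_saturated_edges (V : finType) (n : nat) (G : eograph V)
    (H : eograph 'I_n) :
  1 < n -> (forall u, 1 < #|[set g in edges G | u \in g]|) ->
  saturated_m G H -> n <= 2 * #|edges H|.
Proof.
move=> n_gt1 degG [H_free H_sat].
suff cov x : x \in finset.cover (edges H).
  have -> : 2 * #|edges H| = \sum_(e in edges H) #|e|.
    rewrite mulnC -sum_nat_const; apply: eq_bigr => e eH.
    by rewrite (edges_card2 eH).
  apply: leq_trans (leq_card_cover _).1.
  by rewrite (_ : finset.cover _ = [set: 'I_n]) ?cardsT ?card_ord //; apply/setP => x; rewrite cov inE.
have [y yNx] : exists y : 'I_n, x != y.
  have : 0 < #|[set~ x]| by rewrite cardsC1 card_ord; lia.
  by case/card_gt0P=> y; rewrite !inE eq_sym => yx; exists y.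
have e_card2 : #|[set x; y]| = 2 by rewrite cards2 yNx.
have [eH|eNH] := boolP ([set x; y] \in edges H).
  by apply/bigcupP; exists [set x; y] => //; rewrite !inE eqxx.
have [f fcopy] := H_sat _ e_card2 eNH.
have [f_inj fH _] := fcopy.
have [/existsP[g /andP[gG /eqP fg]]|nofg] :=
    boolP [exists g : {set V}, (g \in edges G) && (f @: g == [set x; y])].
  have : x \in f @: g by rewrite fg !inE eqxx.
  (* As [u] has degree at least two, some edge [h] other than [g] contains it; by injectivity of [f]
     its image is not the new edge, so it lies in [H] and covers [x]. *)
  case/imsetP => u ug xE; have [h] : exists h, (h \in [set g in edges G | u \in g]) && (h != g).
    have [h1 [h2 [h1u h2u h12]]] := card_gt1P (degG u).
    by case: (eqVneq h1 g) h12 => [->|h1g] h12; [exists h2|exists h1];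
      rewrite ?h1u ?h2u // eq_sym.
  rewrite inE => /andP[/andP[hG uh] hg].
  have := fH h hG; rewrite !inE -fg (inj_eq (imset_inj f_inj)) (negbTE hg) /= => fhH.
  by apply/bigcupP; exists (f @: h) => //; rewrite xE imset_f.
case: H_free; exists f; apply: copy_avoiding_new_edge fcopy _ => g gG.
by move: nofg; rewrite negb_exists => /forallP/(_ g); rewrite gG.
Qed.

(** * The complete split graph with two hubs *)

Definition hub n (b : bool) : 'I_n.+2 := if b then @Ordinal n.+2 1 isT else ord0.

Lemma val_hub n b : hub n b = b :> nat. Proof. by case: b. Qed.

Definition hubs n : {set 'I_n.+2} := [set hub n false; hub n true].

Lemma in_hubs n (i : 'I_n.+2) : (i \in hubs n) = (i <= 1).
Proof. by rewrite !inE -!val_eqE /=; case: (val i) => [|[|?]]. Qed.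

Section HubGraph.
(** [t b i] will label the edge from hub [b] to the non-hub [i]; the bound [t_lt] reserves
    [2 * n.+2] for the hub edge as the largest label. *)
Variables (n : nat) (t : bool -> nat -> nat).
Hypothesis t_inj : forall b c (i j : nat), 1 < i < n.+2 -> 1 < j < n.+2 ->
  t b i = t c j -> b = c /\ i = j.
Hypothesis t_lt : forall b (i : nat), 1 < i < n.+2 -> t b i < 2 * n.+2.

Definition hub_edges : {set {set 'I_n.+2}} :=
  [set e : {set 'I_n.+2} | (#|e| == 2) && ~~ [disjoint e & hubs n]].

(* On {hub b, i}, subtracting b from the sum of the vertices recovers i; other
   sets of vertices get irrelevant values. *)
Definition hub_label (e : {set 'I_n.+2}) : nat :=
  if e == hubs n then 2 * n.+2
  else t (hub n true \in e) (\sum_(x in e) x - (hub n true \in e)).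

Lemma hub_neq b (i : 'I_n.+2) : 1 < i -> hub n b != i.
Proof. by move=> i1; rewrite -val_eqE /= val_hub; case: b; lia. Qed.

Lemma hub_labelE b (i : 'I_n.+2) : 1 < i ->
  hub_label [set hub n b; i] = t b i.
Proof.
move=> i1; rewrite /hub_label ifN; last first.
  apply/eqP => /setP/(_ i); rewrite in_hubs !inE eqxx orbT; lia.
have -> : (hub n true \in [set hub n b; i]) = b.
  by rewrite !inE (negbTE (hub_neq true i1)) orbF; case: b.
by rewrite big_setU1 ?inE ?hub_neq //= big_set1 val_hub addKn.
Qed.

Lemma hub_edgesP e : reflect
  (e = hubs n \/ exists b (i : 'I_n.+2), 1 < i /\ e = [set hub n b; i])
  (e \in hub_edges).
Proof.
apply: (iffP idP) => [|[->|[b [i [i1 ->]]]]]; last 2 first.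
- rewrite inE cards2 /=; apply/pred0Pn.
  by exists (hub n true); rewrite /= in_hubs.
- rewrite inE cards2 hub_neq //=; apply/pred0Pn; exists (hub n b).
  by rewrite /= in_hubs val_hub !inE eqxx leq_b1.
rewrite inE => /andP[/cards2P[x [y [xy ->]]] /pred0Pn[z /=]].
rewrite in_hubs => /andP[zxy z1].
wlog zx : x y xy zxy / z = x.
  move=> W; move: (zxy); rewrite !inE => /orP[/eqP|/eqP] zE; first exact: W.
  by rewrite finset.setUC; apply: W; rewrite 1?eq_sym // finset.setUC.
rewrite {}zx {zxy} in z1.
have [c xE] : exists c, x = hub n c.
  by exists (x == 1 :> nat); apply/val_inj; rewrite /= val_hub; case: eqP z1; lia.
have [y1|y1] := leqP y 1; last by right; exists c, y; rewrite xE.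
have yE : y = hub n (~~ c).
  apply/val_inj; rewrite /= val_hub; move: xy; rewrite -val_eqE xE /= val_hub.
  by case: c {xE}; lia.
by left; rewrite xE yE /hubs; case: (c) => //=; rewrite finset.setUC.
Qed.

Fact hub_card2 : {in hub_edges, forall e : {set 'I_n.+2}, #|e| = 2}.
Proof. by move=> e; rewrite inE => /andP[/eqP]. Qed.

Fact hub_label_inj : {in hub_edges &, injective hub_label}.
Proof.
have labM : hub_label (hubs n) = 2 * n.+2 by rewrite /hub_label eqxx.
move=> _ _ /hub_edgesP[->|[b [i [i1 ->]]]] /hub_edgesP[->|[c [j [j1 ->]]]] //;
  rewrite ?labM !hub_labelE // => tE.
- by have := @t_lt c j; rewrite j1 ltn_ord -tE ltnn => /(_ isT).
- by have := @t_lt b i; rewrite i1 ltn_ord tE ltnn => /(_ isT).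
- have ik : 1 < i < n.+2 by rewrite i1 ltn_ord.
  have jk : 1 < j < n.+2 by rewrite j1 ltn_ord.
  by have [-> /val_inj ->] := t_inj ik jk tE.
Qed.

Definition hub_graph : eograph 'I_n.+2 := EOGraph hub_card2 hub_label_inj.

Lemma card_hub_graph : #|edges hub_graph| <= 2 * n.+2.
Proof.
(* [A b] is the star at hub [b], together with a harmless singleton from [i = hub n b]; the hub edge
   is counted in [A false]. *)
set A := fun b => [set [set hub n b; i] | i in 'I_n.+2].
apply: (@leq_trans #|A false :|: A true|).
  apply/subset_leq_card/fintype.subsetP => e /hub_edgesP[->|[b [i [_ ->]]]].
    by rewrite inE; apply/orP; left; apply: imset_f.
  by rewrite inE; apply/orP; case: b; [right|left]; apply: imset_f.
rewrite (leq_trans (leq_card_setU _ _).1) // mul2n -addnn.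
by rewrite leq_add // (leq_trans (leq_imset_card _ _)) ?card_ord.
Qed.

Lemma hub_label_le e : e \in hub_edges -> hub_label e <= 2 * n.+2.
Proof.
case/hub_edgesP=> [->|[b [i [i1 ->]]]]; first by rewrite /hub_label eqxx.
by rewrite hub_labelE // ltnW // t_lt // i1 /=.
Qed.

Lemma hub_edge_ends (x y : 'I_n.+2) :
  [set x; y] \in hub_edges -> (x <= 1) || (y <= 1).
Proof.
rewrite inE => /andP[_ /pred0Pn[z /=]]; rewrite in_hubs !inE.
by case/andP=> /orP[]/eqP-> ->; rewrite ?orbT.
Qed.

(** * Freeness and saturation for diamonds whose first edge is [ab] *)

Section Diamond.
Variable s : seq {set 'I_4}.
(** The order of the 4-cycle is left free, so that [D3], [D4] and [D5] are treated at once. *)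
Hypothesis s_diamond :
  s =i [:: [set va; vv]; [set va; vw]; [set vb; vv]; [set vb; vw]].
Hypothesis s_card2 : all (fun e : {set 'I_4} => #|e| == 2) ([set va; vb] :: s).

Let D := eograph_of_list s_card2.

Let inD e : (e \in edges D) =
  (e \in [:: [set va; vb]; [set va; vv]; [set va; vw]; [set vb; vv]; [set vb; vw]]).
Proof. by rewrite !inE s_diamond !inE. Qed.

Lemma diamond_min_degree u : 1 < #|[set g in edges D | u \in g]|.
Proof.
have wit x p q : p != q -> p != x -> [set x; p] \in edges D ->
    [set x; q] \in edges D -> 1 < #|[set g in edges D | x \in g]|.
  move=> pq px pD qD; apply/card_gt1P; exists [set x; p], [set x; q].
  split; rewrite 1?inE ?pD ?qD ?set21 //.
  by apply/eqP => /setP/(_ p); rewrite !inE (negbTE pq) (negbTE px) eqxx.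
case: u => [[|[|[|[|//]]]] lt4].
- rewrite (_ : Ordinal lt4 = va); last exact/val_inj.
  by apply: (wit _ vv vw); rewrite // inD !inE eqxx ?orbT.
- rewrite (_ : Ordinal lt4 = vb); last exact/val_inj.
  by apply: (wit _ vv vw); rewrite // inD !inE eqxx ?orbT.
- rewrite (_ : Ordinal lt4 = vv); last exact/val_inj.
  by apply: (wit _ va vb); rewrite // finset.setUC inD !inE eqxx ?orbT.
- rewrite (_ : Ordinal lt4 = vw); last exact/val_inj.
  by apply: (wit _ va vb); rewrite // finset.setUC inD !inE eqxx ?orbT.
Qed.

Lemma hub_graph_free : eo_free D hub_graph.
Proof.
case=> f [f_inj fH ford].
have ends x y : [set x; y] \in edges D -> (f x <= 1) || (f y <= 1).
  by move/fH; rewrite imsetU1 imset_set1 => /hub_edge_ends.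
have neq x y : x != y -> f x != f y :> nat.
  by move=> xy; rewrite val_eqE (inj_eq f_inj).
have abD : [set va; vb] \in edges D by rewrite inD !inE eqxx.
have avD : [set va; vv] \in edges D by rewrite inD !inE eqxx ?orbT.
have abH : f @: [set va; vb] = hubs n.
  (* The vertices sent to hubs form a vertex cover of the diamond with at most two elements, and
     [va], [vb] give the only such cover. *)
  have Eab := ends _ _ abD; have Eav := ends _ _ avD.
  have Eaw : (f va <= 1) || (f vw <= 1) by apply: ends; rewrite inD !inE eqxx ?orbT.
  have Ebv : (f vb <= 1) || (f vv <= 1) by apply: ends; rewrite inD !inE eqxx ?orbT.
  have Ebw : (f vb <= 1) || (f vw <= 1) by apply: ends; rewrite inD !inE eqxx ?orbT.
  have Nab := @neq va vb isT; have Nav := @neq va vv isT.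
  have Naw := @neq va vw isT; have Nbv := @neq vb vv isT.
  have Nbw := @neq vb vw isT; have Nvw := @neq vv vw isT.
  rewrite imsetU1 imset_set1; apply/setP => i.
  rewrite in_hubs !inE -!val_eqE /=; lia.
have lt_abv : label D [set va; vb] < label D [set va; vv].
  rewrite /= eqxx; case: eqP => // /setP/(_ vb); by rewrite !inE.
(* The image of [ab] has the largest label, yet would have to precede the image of [av]. *)
have := ford _ _ abD avD; rewrite lt_abv abH /= {1}/hub_label eqxx => lt_hub.
by have := hub_label_le (fH _ avD); rewrite leqNgt lt_hub.
Qed.

(** The missing edge [xy] plays [ab], and the hub edge falls on the non-adjacent pair [vv], [vw].
    The default of [nth] is never reached. *)
Definition diamond_emb (x y : 'I_n.+2) (i : 'I_4) : 'I_n.+2 :=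
  nth x [:: x; y; hub n false; hub n true] i.

Lemma diamond_embE x y : let f := diamond_emb x y in
  ((f @: [set va; vb] = [set x; y]) *
   (f @: [set va; vv] = [set hub n false; x]) *
   (f @: [set va; vw] = [set hub n true; x]) *
   (f @: [set vb; vv] = [set hub n false; y]) *
   (f @: [set vb; vw] = [set hub n true; y]))%type.
Proof. by rewrite /= !imsetU1 !imset_set1; do !split; rewrite // finset.setUC. Qed.

(** This is where the labeling must match the order of [s]. Taking [x < y] loses nothing, since the
    missing edge is unordered. *)
Hypothesis t_sorted : forall x y : 'I_n.+2, 1 < x < y ->
  sorted ltn [seq hub_label (diamond_emb x y @: e) | e : {set 'I_4} <- s].

Lemma hub_graph_saturated : saturated_m D hub_graph.
Proof.
split=> [|e e_card2 eNH]; first exact: hub_graph_free.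
have [x [y [x1 xy eE]]] : exists x y : 'I_n.+2, [/\ 1 < x, x < y & e = [set x; y]].
  move/eqP/cards2P: (e_card2) => [x [y [xy eE]]].
  have hubN (z : 'I_n.+2) : z \in e -> 1 < z.
    move=> ze; rewrite ltnNge -in_hubs; move: eNH; rewrite inE e_card2 eqxx negbK.
    by move/disjointFr => ->.
  have x1 : 1 < x by apply: hubN; rewrite eE set21.
  have y1 : 1 < y by apply: hubN; rewrite eE set22.
  case: (ltngtP x y) => [lt|gt|/val_inj xyE].
  - by exists x, y.
  - by exists y, x; rewrite finset.setUC.
  - by rewrite xyE eqxx in xy.
have emb_inj : injective (diamond_emb x y).
  move=> i j /eqP; rewrite nth_uniq ?ltn_ord //; first by move/eqP/val_inj.
  by rewrite /= !inE -!val_eqE /=; lia.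
have s_neq g : g \in s -> diamond_emb x y @: g != e.
  rewrite eE -(diamond_embE x y) (inj_eq (imset_inj emb_inj)) s_diamond.
  by rewrite !inE => /or4P[]/eqP->; apply/eqP => /setP;
    [move/(_ vb)|move/(_ vb)|move/(_ va)|move/(_ va)]; rewrite !inE.
exists (diamond_emb x y); apply: copy_of_list => //= [g|].
  rewrite inE => /orP[/eqP->|gs]; first by rewrite diamond_embE eE setU11.
  apply/setU1P; right; apply/hub_edgesP; right; move: gs; rewrite s_diamond !inE.
  have y1 := ltn_trans x1 xy.
  by case/or4P=> /eqP->; rewrite diamond_embE;
    [exists false, x|exists true, x|exists false, y|exists true, y].
rewrite diamond_embE -eE eqxx.
(* The image of [ab] has label 0; the 4-cycle avoids the new edge, so its labels are successors and
   sortedness reduces to [t_sorted]. *)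
have /eq_in_map -> : {in s, (fun g : {set 'I_4} =>
    if diamond_emb x y @: g == e then 0 else (hub_label (diamond_emb x y @: g)).+1)
  =1 (fun g => (hub_label (diamond_emb x y @: g)).+1)}.
  by move=> g /s_neq/negbTE->.
rewrite path_min_sorted; last by apply/allP => _ /mapP[g _ ->].
have := @t_sorted x y; rewrite x1 xy => /(_ isT); rewrite !sorted_map.
by apply: sub_sorted => g h /=.
Qed.

Lemma sat_m_diamond : n.+2 <= 2 * sat_m n.+2 D /\ sat_m n.+2 D <= 2 * n.+2.
Proof.
have D0 : edges D != finset.set0.
  by apply/finset.set0Pn; exists [set va; vb]; rewrite inD !inE eqxx.
have [[H [Hsat HE]] min] := sat_mP n.+2 D0.
split; first by rewrite -HE; apply: leq_saturated_edges diamond_min_degree Hsat.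
apply: leq_trans card_hub_graph; apply: min.
by exists hub_graph; split=> //; apply: hub_graph_saturated.
Qed.

End Diamond.
End HubGraph.

(** * The three labelings *)

Lemma sat_m_D3 n : n.+2 <= 2 * sat_m n.+2 D3 /\ sat_m n.+2 D3 <= 2 * n.+2.
Proof.
(* Both edges at [x] precede both edges at [y]. *)
pose t (b : bool) i := 2 * i + b.
apply: (@sat_m_diamond n t) => [b c i j _ _|b i|e|x y /andP[x1 xy]].
- by rewrite /t; case: b; case: c; lia.
- by rewrite /t; case: b; lia.
- by rewrite !inE.
- rewrite /= !diamond_embE !hub_labelE ?(ltn_trans x1 xy) // /t /=; lia.
Qed.

Lemma sat_m_D4 n : n.+2 <= 2 * sat_m n.+2 D4 /\ sat_m n.+2 D4 <= 2 * n.+2.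
Proof.
(* All non-hub edges at the first hub precede those at the second, each block increasing in [i]. *)
pose t (b : bool) i := b * n.+2 + i.
apply: (@sat_m_diamond n t) => [b c i j|b i|e|x y /andP[x1 xy]].
- by rewrite /t; case: b; case: c; lia.
- by rewrite /t; case: b; lia.
- by rewrite !inE; congr (_ || _); rewrite orbCA.
- rewrite /= !diamond_embE !hub_labelE ?(ltn_trans x1 xy) // /t /=.
  have := ltn_ord y; lia.
Qed.

Lemma sat_m_D5 n : n.+2 <= 2 * sat_m n.+2 D5 /\ sat_m n.+2 D5 <= 2 * n.+2.
Proof.
(* The second block is reversed; as [i < n.+2], its labels still exceed those of the first. *)
pose t (b : bool) i := if b then 2 * n.+2 - i else i.
apply: (@sat_m_diamond n t) => [b c i j|b i|e|x y /andP[x1 xy]].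
- by rewrite /t; case: b; case: c; lia.
- by rewrite /t; case: b; lia.
- by rewrite !inE; do !case: (_ == _).
- rewrite /= !diamond_embE !hub_labelE ?(ltn_trans x1 xy) // /t.
  have := ltn_ord y; lia.
Qed.

(** * From explicit bounds to asymptotics *)

Import Order.TTheory GRing.Theory Num.Theory.
Local Open Scope classical_set_scope.
Local Open Scope ring_scope.

Lemma Theta_linear (R : realType) (u : nat -> nat) :
  (forall n, n.+2 <= 2 * u n.+2 /\ u n.+2 <= 2 * n.+2)%N ->
  (fun n : nat => (u n)%:R : R^o) \is 'Theta_\oo (fun n : nat => n%:R : R^o).
Proof.
(* The constants 1/2 and 2 come from [n <= 2 * u n] and [u n <= 2 * n], valid once [n >= 2]. *)
move=> u_bd; apply/asboolP; exists (2%:R^-1, 2%:R); first by rewrite /= invr_gt0 !ltr0n.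
have {}u_bd n : (2 <= n -> n <= 2 * u n /\ u n <= 2 * n)%N.
  case: n => [|[|n]] // _; have := u_bd n; lia.
near=> n; have [lb ub] : (n <= 2 * u n /\ u n <= 2 * n)%N.
  by apply: u_bd; near: n; exact: nbhs_infty_ge.
by rewrite /= !normr_nat -!natrM ler_nat mulrC ler_pdivrMr ?ltr0n // -natrM ler_nat mulnC.
Unshelve. all: by end_near. Qed.

Theorem claim26 (R : realType) :
  [/\ (fun n : nat => (sat_m n D3)%:R : R^o)
        \is 'Theta_\oo (fun n : nat => n%:R : R^o),
      (fun n : nat => (sat_m n D4)%:R : R^o)
        \is 'Theta_\oo (fun n : nat => n%:R : R^o)
    & (fun n : nat => (sat_m n D5)%:R : R^o)
        \is 'Theta_\oo (fun n : nat => n%:R : R^o)].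
Proof.
by split; apply: Theta_linear; [exact: sat_m_D3|exact: sat_m_D4|exact: sat_m_D5].
Qed.
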